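(* Let $\mu^+$ be a finite nonnegative Borel measure on $[0,\infty)$ whose support is unbounded, and assume $\inf_{s>0}M_{s,\sigma_s}(e_s)>0$ and that $s\mapsto\nu_s(A)$ is $\mu^+$-measurable for every Borel $A$. Then there exists $u\in C^\infty_c(B_1)$ such that $$\int_{[0,\infty)}\mathcal E_{2s_1,s}(u,u)\,\mu^+(ds)=+\infty.$$
   Context: For $s>0$, $\sigma_s$ is a Borel probability measure on $\mathbb S^{N-1}$ and $\nu_s(U)=\int_0^\infty\int_{\mathbb S^{N-1}}\chi_U(r\theta)r^{-1-2s}\sigma_s(d\theta)\,dr$; $M_{s,\sigma}(e)=\int|e\cdot\theta|^{2s}\sigma(d\theta)$; $e_s$ a maximum point of $M_{s,\sigma_s}$; for integer $k>s$, $\frac2{c_{k,s}}=2^k\int(1-\cos(e_s\cdot y))^k\nu_s(dy)$; $\delta_mu(x,y)=\sum_{j=-m}^m(-1)^j\binom{2m}{m-j}u(x+jy)$. For $s\ge0$, $s_1=\min\{n\in\mathbb Z:n>s\}$; for $s>0$, $\mathcal E_{2s_1,s}(u,u)=\frac{c_{2s_1,s}}2\iint_{\mathbb R^{2N}}(\delta_{s_1}u(x,y))^2dx\,\nu_s(dy)$, and $\mathcal E_{2,0}(u,u)=\|u\|^2_{L^2(\mathbb R^N)}$. $B_1$ is the unit ball of $\mathbb R^N$. *)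

(* Defs.v *)
From HB Require Import structures.
From mathcomp Require Import all_boot all_order all_algebra.
From mathcomp Require Import all_classical all_reals all_analysis.
From mathcomp Require Import measurable_realfun.
Set Implicit Arguments. Unset Strict Implicit. Unset Printing Implicit Defensive.
Import Order.TTheory GRing.Theory Num.Theory.
Import numFieldNormedType.Exports.
Local Open Scope classical_set_scope.
Local Open Scope ring_scope.

Section Defs.
Variable R : realType.

Definition dotp (N : nat) (x y : 'rV[R]_N) : R := \sum_(i < N) x 0 i * y 0 i.
Definition sphere (N : nat) : set 'rV[R]_N := [set x | dotp x x = 1].
Definition unit_ball (N : nat) : set 'rV[R]_N := [set x | dotp x x < 1].

Definition RN (N : nat) := g_sigma_algebraType (@open 'rV[R]_N).

Fixpoint iterD (N : nat) (vs : seq 'rV[R]_N) (f : 'rV[R]_N -> R) : 'rV[R]_N -> R :=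
  match vs with
  | [::] => f
  | v :: vs' => fun x => 'D_v (iterD vs' f) x
  end.
Definition smooth (N : nat) (f : 'rV[R]_N -> R) : Prop :=
  forall (vs : seq 'rV[R]_N) (x : 'rV[R]_N), differentiable (iterD vs f) x.
Definition Cc_infty_B1 (N : nat) (u : 'rV[R]_N -> R) : Prop :=
  smooth u /\ compact (closure [set x | u x != 0]) /\
  closure [set x | u x != 0] `<=` @unit_ball N.

(* Lebesgue integral over R^N of a nonnegative function, as iterated
   one-dimensional Lebesgue integrals (Tonelli). *)
Fixpoint iint (n : nat) : ('rV[R]_n -> \bar R) -> \bar R :=
  match n return ('rV[R]_n -> \bar R) -> \bar R with
  | 0%N => fun f => f 0
  | n'.+1 => fun f =>
      (\int[@lebesgue_measure R]_t iint (fun x : 'rV[R]_n' => f (row_mx (const_mx t : 'rV[R]_1) x)))%E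
  end.

(* integral of a nonnegative g against
   nu_s(U) = int_0^oo int_S chi_U(r theta) r^{-1-2s} sigma_s(dtheta) dr *)
Definition nu_int (N : nat) (sigma : {measure set (RN N) -> \bar R}) (s : R)
    (g : 'rV[R]_N -> \bar R) : \bar R :=
  (\int[@lebesgue_measure R]_(r in `]0%R, +oo[%classic)
     \int[sigma]_theta (g (r *: (theta : 'rV[R]_N)) * (r `^ (- 1 - 2 * s))%:E))%E.

Definition nu (N : nat) (sigma : {measure set (RN N) -> \bar R}) (s : R)
    (A : set 'rV[R]_N) : \bar R :=
  nu_int sigma s (fun y => (\1_A y)%:E).

Definition Mfun (N : nat) (s : R) (sigma : {measure set (RN N) -> \bar R})
    (e : 'rV[R]_N) : \bar R :=
  (\int[sigma]_theta (`|dotp e (theta : 'rV[R]_N)| `^ (2 * s))%:E)%E.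

Definition cks (N : nat) (sigma : {measure set (RN N) -> \bar R})
    (es : 'rV[R]_N) (k : nat) (s : R) : R :=
  2 / (2 ^+ k * fine (nu_int sigma s (fun y => ((1 - cos (dotp es y)) ^+ k)%:E))).

(* s_1 = min {n in Z : n > s}, for s >= 0 *)
Definition s1 (s : R) : nat := (Num.truncn s).+1.

Definition delta (N : nat) (m : nat) (u : 'rV[R]_N -> R) (x y : 'rV[R]_N) : R :=
  \sum_(0 <= i < (2 * m).+1)
    let j : int := (i%:Z - m%:Z)%R in
    ((-1) ^ j * ('C(2 * m, (2 * m - i)%N))%:R * u (x + j%:~R *: y)).

Definition Eform (N : nat) (sigma : R -> {measure set (RN N) -> \bar R})
    (e : R -> 'rV[R]_N) (s : R) (u : 'rV[R]_N -> R) : \bar R :=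
  if s == 0 then iint (fun x => (u x ^+ 2)%:E)
  else ((cks (sigma s) (e s) (2 * s1 s) s / 2)%:E *
        nu_int (sigma s) s (fun y => iint (fun x => (delta (s1 s) u x y ^+ 2)%:E)))%E.

Definition msupp (mu : {measure set R -> \bar R}) : set R :=
  [set x | forall eps : R, 0 < eps -> (0 < mu (ball x eps))%E].

Definition mu_measurable (mu : {measure set R -> \bar R}) (D : set R)
    (g : R -> \bar R) : Prop :=
  exists h : R -> \bar R, measurable_fun setT h /\
    {ae mu, forall s, D s -> g s = h s}.

End Defs.

(* Main.v *)
(** The function is u(x) = prod_i w(x_i), where w is a sum of infinitely many rescaled copies
    of one smooth bump, accumulating at 0; the n-th copy has width b_n and height b_n^floor(n/2N).
    If x lies in the n-th bump and |y| is comparable to b_n, every term of delta_m u(x,y) except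
    the central one vanishes, because the gaps between bumps are much larger than b_n. Hence for
    s in [n,n+1) the energy is at least a constant K_n times b_n^(N-n) (the normalizing constant
    is bounded below there, and it is not degenerate because M_s(e_s) > 0), and b_n can be chosen
    so small that for n > N the energy exceeds n / mu[n,n+1) when mu[n,n+1) > 0. Since the
    heights decay faster than every fixed power of b_n, u is smooth, and since mu charges
    infinitely many intervals [n,n+1) the integral diverges. *)
Require Import Defs.
From HB Require Import structures.
From mathcomp Require Import all_boot all_order all_algebra.
From mathcomp Require Import all_classical all_reals all_analysis.
From mathcomp Require Import measurable_realfun.
From mathcomp Require Import ring lra zify.
Import Order.TTheory GRing.Theory Num.Theory.
Import numFieldNormedType.Exports HBNNSimple.
Local Open Scope classical_set_scope.
Local Open Scope ring_scope.

(** * Comparison of integrals of nonnegative functions *)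

Section MonotoneIntegral.
Context {d : measure_display} {T : measurableType d} {R : realType}.
Variable mu : {measure set T -> \bar R}.
Local Open Scope ereal_scope.

(** The integral of a nonnegative function is a supremum over the simple functions below it, so the
    comparison holds for arbitrary [f] and [g], measurable or not. *)
Lemma le_integral_subset (D1 D2 : set T) (f g : T -> \bar R) :
  (forall x, D1 x -> 0 <= f x) -> (forall x, D2 x -> 0 <= g x) ->
  D1 `<=` D2 -> (forall x, D1 x -> f x <= g x) ->
  \int[mu]_(x in D1) f x <= \int[mu]_(x in D2) g x.
Proof.
move=> f0 g0 sD fg; rewrite !ge0_integralE//.
apply: ereal_sup_le => _ [h hf <-].
exists h => //= x; apply: le_trans (hf x) _; rewrite /patch.
case: ifPn => [/set_mem D1x|_]; first by rewrite (mem_set (sD _ D1x)) fg.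
by case: ifPn => // /set_mem; exact: g0.
Qed.

Lemma integral_ge_cst (D A : set T) (c : R) (f : T -> \bar R) :
  measurable A -> A `<=` D -> (0 <= c)%R ->
  (forall x, D x -> 0 <= f x) -> (forall x, A x -> c%:E <= f x) ->
  c%:E * mu A <= \int[mu]_(x in D) f x.
Proof.
move=> mA AD c0 f0 cf; rewrite -integral_cst//.
by apply: le_integral_subset => // x _; rewrite lee_fin.
Qed.

(** Here [f] is again arbitrary: it is dominated by [c] plus the measurable function equal to [+oo]
    on the null complement of [A] and to 0 on [A]. *)
Lemma integral_le_cst_ae (A : set T) (c : R) (f : T -> \bar R) :
  measurable A -> mu (~` A) = 0 -> mu setT = 1 -> (0 <= c)%R ->
  (forall x, 0 <= f x) -> (forall x, A x -> f x <= c%:E) ->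
  \int[mu]_x f x <= c%:E.
Proof.
move=> mA mA0 mT c0 f0 fc.
have mcy : measurable_fun setT ((cst +oo : T -> \bar R) \_ (~` A)).
  apply/(measurable_restrictT _ (measurableC mA)).1; exact: measurable_cst.
have cy0 x : 0 <= ((cst +oo : T -> \bar R) \_ (~` A)) x.
  by rewrite /patch; case: ifP => _ /=; rewrite ?leey ?lexx.
apply: (@le_trans _ _ (\int[mu]_x (c%:E + ((cst +oo : T -> \bar R) \_ (~` A)) x))).
  apply: le_integral_subset => // [x _|x _]; first by rewrite adde_ge0.
  rewrite /patch; case: ifPn => [_|xA]; first by rewrite addey ?leey.
  rewrite adde0; apply: fc; apply: contrapT => nA.
  by move/negP: xA; apply; exact/mem_set.
rewrite ge0_integralD//.
rewrite -integral_mkcond !integral_cst//; last exact: measurableC.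
by rewrite mA0 mT mule0 adde0 mule1.
Qed.

End MonotoneIntegral.

(** * Iterated Lebesgue integrals *)

Section IteratedIntegral.
Context {R : realType}.

Lemma iint_ge0 n (f : 'rV[R]_n -> \bar R) :
  (forall x, (0 <= f x)%E) -> (0 <= iint f)%E.
Proof.
elim: n f => [|n IH] f f0 /=; first exact: f0.
by apply: integral_ge0 => t _; apply: IH.
Qed.

Lemma iint_ge_box n (f : 'rV[R]_n -> \bar R) (a b c : R) :
  a <= b -> 0 <= c -> (forall x, (0 <= f x)%E) ->
  (forall x : 'rV[R]_n, (forall i, a <= x 0 i <= b) -> (c%:E <= f x)%E) ->
  ((c * (b - a) ^+ n)%:E <= iint f)%E.
Proof.
move=> ab; elim: n f c => [|n IH] f c c0 f0 fc /=.
  by rewrite expr0 mulr1; apply: fc => -[].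
have ba0 : 0 <= b - a by rewrite subr_ge0.
rewrite exprSr mulrA EFinM.
have -> : (b - a)%:E = (@lebesgue_measure R) `[a, b]%classic.
  rewrite lebesgue_measure_itv/= lte_fin lt_neqAle ab andbT.
  by case: eqP => [->|]//=; rewrite subrr.
apply: integral_ge_cst => //.
- by rewrite mulr_ge0 ?exprn_ge0.
- by move=> t _; apply: iint_ge0.
- move=> t /=; rewrite in_itv/= => tab; apply: IH => // x xab.
  apply: fc => i; case: (@split_ordP 1 n i) => j ->.
    by rewrite (@row_mxEl _ 1 1 n) mxE.
  by rewrite (@row_mxEr _ 1 1 n).
Qed.

End IteratedIntegral.

(** * The unit sphere and its Borel subsets *)

Lemma continuous_bigsum {R : realType} {T : topologicalType} (I : Type) (r : seq I)
    (f : I -> T -> R) :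
  (forall i, continuous (f i)) -> continuous (fun x => \sum_(i <- r) f i x).
Proof.
move=> cf; elim: r => [|i r IH] x.
  rewrite (_ : (fun _ => _) = cst 0); last by apply/funext => y; rewrite big_nil.
  exact: cvg_cst.
rewrite (_ : (fun _ => _) = f i \+ (fun x => \sum_(j <- r) f j x)); last first.
  by apply/funext => y; rewrite big_cons.
by apply: cvgD; [exact: cf | exact: IH].
Qed.

Section Sphere.
Context {R : realType} {N : nat}.
Implicit Types x y e th : 'rV[R]_N.

Lemma dotpZr e (r : R) x : dotp e (r *: x) = r * dotp e x.
Proof. by rewrite /dotp mulr_sumr; apply: eq_bigr => i _; rewrite mxE mulrCA. Qed.

Lemma dotp_le1 x y : @sphere R N x -> @sphere R N y -> `|dotp x y| <= 1.
Proof.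
rewrite /sphere /= => hx hy.
(* For [c] equal to 1 or -1 this is the nonnegativity of the squared norm of [x + c y]. *)
have H (c : R) : c ^+ 2 = 1 -> 0 <= 2 + 2 * c * dotp x y.
  move=> c1.
  have -> : 2 + 2 * c * dotp x y = \sum_(i < N) (x 0 i + c * y 0 i) ^+ 2.
    transitivity (dotp x x + c ^+ 2 * dotp y y + 2 * c * dotp x y).
      by rewrite hx hy c1 mulr1.
    rewrite /dotp !mulr_sumr -!big_split/=; apply: eq_bigr => i _; ring.
  by apply: sumr_ge0 => i _; exact: sqr_ge0.
have := H 1 (expr1n _ _); have := H (-1) _; rewrite sqrrN expr1n => /(_ erefl).
by rewrite ler_norml; lra.
Qed.

Lemma dotp_continuous e : continuous (dotp e).
Proof.
apply: (@continuous_bigsum _ _ _ _ (fun i (z : 'rV[R]_N) => e 0 i * z 0 i)) => i x.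
apply: (@continuousM _ _ (cst (e 0 i)) (fun z : 'rV[R]_N => z 0 i)).
  exact: cst_continuous.
exact: coord_continuous.
Qed.

Lemma sphere_closed : closed (@sphere R N).
Proof.
rewrite (_ : @sphere R N = (fun x => dotp x x) @^-1` [set 1]) //.
apply: preimage_closed => [x _|]; last exact: closed_eq.
apply: (@continuous_bigsum _ _ _ _ (fun i (z : 'rV[R]_N) => z 0 i * z 0 i)) => i {}x.
by apply: (@continuousM _ _ (fun z : 'rV[R]_N => z 0 i) (fun z : 'rV[R]_N => z 0 i));
   exact: coord_continuous.
Qed.

Lemma open_measurable_RN (A : set 'rV[R]_N) : open A -> measurable (A : set (@RN R N)).
Proof. by move=> oA; apply: sub_gen_smallest. Qed.

Lemma sphere_measurable : measurable (@sphere R N : set (@RN R N)).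
Proof.
rewrite -[X in measurable X]setCK; apply: measurableC.
by apply: open_measurable_RN; apply: closed_openC; exact: sphere_closed.
Qed.

Lemma dotp_gt_measurable e (del : R) :
  measurable ([set th : 'rV[R]_N | del < `|dotp e th|] : set (@RN R N)).
Proof.
apply: open_measurable_RN.
rewrite (_ : [set th : 'rV[R]_N | _] = (fun th => `|dotp e th|) @^-1` `]del, +oo[%classic).
  apply: open_comp => [th _|]; last exact: interval_open.
  apply: continuous_comp; [exact: dotp_continuous|exact: norm_continuous].
by apply/seteqP; split => th /=; rewrite in_itv/= andbT.
Qed.

End Sphere.

(** * Bounds on the cosine kernel *)

Section CosineKernel.
Context {R : realType}.

(** The mean value theorem, applied to [cos] and then to [sin], gives [1 - cos x = x * sin c] with
    [sin c <= c <= x]. *)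
Lemma oneBcos_le_sqr (z : R) : 1 - cos z <= z ^+ 2.
Proof.
have H (x : R) : 0 <= x -> 1 - cos x <= x ^+ 2.
  move=> x0.
  have [|c cx] := @MVT_segment R cos (fun t => - sin t) 0 x x0.
    by apply: continuous_subspaceT => t; exact: continuous_cos.
  rewrite cos0 subr0 mulNr => h.
  move: cx; rewrite in_itv/= => /andP[c0 cx].
  have [|d _] := @MVT_segment R sin cos 0 c c0.
    by apply: continuous_subspaceT => t; exact: continuous_sin.
  rewrite sin0 !subr0 => h2.
  have sx : sin c <= x.
    by rewrite h2; apply: le_trans cx; rewrite ler_piMl// cos_le1.
  have -> : 1 - cos x = sin c * x by lra.
  by rewrite expr2 ler_wpM2r.
have [/H//|/ltW z0] := leP 0 z.
by rewrite -cosN -sqrrN; apply: H; rewrite oppr_ge0.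
Qed.

Lemma oneBcos_ge0 (z : R) : 0 <= 1 - cos z.
Proof. by rewrite subr_ge0 cos_le1. Qed.

(** A majorant integrable in [r], uniform in [s]. For [r <= 1], [1 - cos z <= r^2] yields a factor
    [r^(4n+4)] that absorbs [r^-(2n+3)]; for [r > 1], [1 - cos z <= 2] and the power of [r] is at
    most [r^-2]. In both cases multiplying by [1 + r^2] costs at most a factor 2. *)
Lemma cosine_kernel_le (n : nat) (s r z : R) :
  (0 < n)%N -> n%:R <= s < n.+1%:R -> 0 < r -> `|z| <= r ->
  (1 - cos z) ^+ (2 * n.+1) * r `^ (- 1 - 2 * s) <=
  2 ^+ (2 * n.+1).+1 * (oneDsqr r)^-1.
Proof.
move=> n0 /andP[ns sn] r0 zr.
have p0 := oneBcos_ge0 z.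
have d0 : 0 < oneDsqr r by apply: lt_le_trans (oneDsqr_ge1 r).
have n1 : 1 <= n%:R :> R by rewrite ler1n.
have sn' : s < n%:R + 1 by rewrite -natr1 in sn.
rewrite ler_pdivlMr//.
suff [c [c0 c1 c2]] : exists c : R, [/\ 0 <= c,
    (1 - cos z) ^+ (2 * n.+1) * r `^ (- 1 - 2 * s) <= 2 ^+ (2 * n.+1) * c &
    c * oneDsqr r <= 2].
  rewrite exprSr; apply: le_trans (_ : 2 ^+ (2 * n.+1) * c * oneDsqr r <= _).
    by rewrite ler_pM2r.
  by rewrite -mulrA ler_pM2l ?exprn_gt0.
have [r1|r1] := leP r 1.
  exists 1; split => //; last by rewrite mul1r /oneDsqr; nra.
  apply: (@le_trans _ _ ((r ^+ 2) ^+ (2 * n.+1) * (r ^+ (2 * n).+3)^-1)).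
    apply: ler_pM; rewrite ?exprn_ge0 ?powR_ge0//.
      apply: lerXn2r; rewrite ?nnegrE ?sqr_ge0//.
      apply: le_trans (oneBcos_le_sqr z) _.
      by rewrite -[z ^+ 2]real_normK ?num_real// ler_pXn2r ?nnegrE// ltW.
    rewrite -powR_invn ?(ltW r0)//; apply: ger_powR; first by rewrite r0.
    by rewrite -!natr1 natrM; lra.
  apply: (@le_trans _ _ 1); last by rewrite mulr1 exprn_ege1// ler1n.
  rewrite -ler_pdivlMr ?invr_gt0 ?exprn_gt0// mul1r invrK -exprM.
  by apply: ler_wiXn2l; rewrite ?(ltW r0)//; lia.
exists (r ^- 2); split; first by rewrite invr_ge0 exprn_ge0 ?ltW.
  apply: ler_pM; rewrite ?exprn_ge0 ?powR_ge0//.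
    by apply: lerXn2r; rewrite ?nnegrE//; have := cos_geN1 z; lra.
  rewrite -powR_invn ?(ltW r0)//; apply: ler_powR; first exact: ltW.
  lra.
rewrite mulrC ler_pdivrMr ?exprn_gt0// /oneDsqr; nra.
Qed.

End CosineKernel.

(** * The integral in the normalizing constant: upper bound and positivity *)

Section NormalizingConstant.
Context {R : realType} {N : nat}.
Variables (sigma : {measure set (@RN R N) -> \bar R}) (n : nat) (s : R) (e : 'rV[R]_N).
Hypotheses (sigmaT : sigma setT = 1%E) (sigmaC : sigma (~` @sphere R N) = 0%E).
Hypotheses (n_gt0 : (0 < n)%N) (ns : n%:R <= s < n.+1%:R).
Hypotheses (e_sphere : @sphere R N e) (M_gt0 : (0 < Mfun s sigma e)%E).

Let s_gt0 : 0 < s.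
Proof. by have /andP[h _] := ns; apply: lt_le_trans h; rewrite ltr0n. Qed.

(** The kernel is dominated by a multiple of [1 / (1 + r^2)], whose integral over the half-line is
    [pi / 2], and [sigma] has mass 1. The bound is the same for all [s] in [[n, n+1)]. *)
Lemma nu_int_cos_le :
  (nu_int sigma s (fun y => ((1 - cos (dotp e y)) ^+ (2 * n.+1))%:E) <=
   (2 ^+ (2 * n.+1).+1 * (pi / 2))%:E)%E.
Proof.
rewrite EFinM -integral0y_oneDsqr -ge0_integralZl_EFin//; last first.
  apply/measurable_EFinP; apply: measurable_funTS.
  by apply: continuous_measurable_fun; exact: continuous_oneDsqrV.
apply: le_integral_subset.
- move=> r _; apply: integral_ge0 => th _.
  by rewrite -EFinM lee_fin mulr_ge0 ?powR_ge0// exprn_ge0// oneBcos_ge0.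
- move=> r _; rewrite -EFinM lee_fin mulr_ge0 ?exprn_ge0//.
- by move=> r; rewrite /= !in_itv/= !andbT; exact: ltW.
- move=> r /=; rewrite in_itv/= andbT => r0.
  rewrite -EFinM; apply: (@integral_le_cst_ae _ (@RN R N) R sigma (@sphere R N)) => //.
  + exact: sphere_measurable.
  + by move=> th; rewrite -EFinM lee_fin mulr_ge0 ?powR_ge0// exprn_ge0// oneBcos_ge0.
  + move=> th Sth; rewrite -EFinM lee_fin; apply: cosine_kernel_le => //.
    by rewrite dotpZr normrM (ger0_norm (ltW r0)) ler_piMr ?(ltW r0)// dotp_le1.
Qed.

(** If all these sets were null, then [M] would be at most [del^(2s)] for every [del] in [(0, 1]],
    hence 0. *)
Lemma sigma_dotp_gt0 : exists2 del : R, 0 < del <= 1 &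
  (0 < sigma [set th : 'rV[R]_N | (del < `|dotp e th|)%R])%E.
Proof.
apply: contrapT => H.
have z (del : R) : 0 < del <= 1 -> sigma [set th : 'rV[R]_N | del < `|dotp e th|] = 0%E.
  move=> h; apply/eqP; rewrite eq_le measure_ge0 andbT leNgt; apply/negP => p.
  by apply: H; exists del.
have Mle (del : R) : 0 < del <= 1 -> (Mfun s sigma e <= (del `^ (2 * s))%:E)%E.
  move=> h; have /andP[d0 d1] := h.
  rewrite /Mfun; apply: (@integral_le_cst_ae _ (@RN R N) R sigma
    (~` [set th : 'rV[R]_N | del < `|dotp e th|])) => //.
  - by apply: measurableC; exact: dotp_gt_measurable.
  - by rewrite setCK z.
  - exact: powR_ge0.
  - move=> th /= /negP; rewrite -leNgt => hth; rewrite lee_fin.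
    by apply: ge0_ler_powR; rewrite ?nnegrE ?(ltW d0)// mulr_ge0// ltW.
move: M_gt0; case E : (Mfun s sigma e) => [m| |] //; last first.
  by have := Mle 1; rewrite E ltr01 lexx => /(_ isT); rewrite leye_eq.
rewrite lte_fin => m0.
have s2 : 1 <= 2 * s.
  have /andP[h _] := ns.
  have n1 : 1 <= n%:R :> R by rewrite ler1n.
  lra.
(* As [2 * s >= 1], this choice gives [del^(2s) <= del <= m / 2 < m]. *)
pose del := Num.min 1 (m / 2).
have d01 : 0 < del <= 1 by rewrite lt_min ltr01 divr_gt0//= ge_min lexx.
have := Mle _ d01; rewrite E lee_fin leNgt => /negP; apply.
apply: le_lt_trans (ge1r_powR d01 s2) _.
by rewrite (@le_lt_trans _ _ (m / 2))// ?ge_min ?lexx ?orbT//; lra.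
Qed.

(** Positivity keeps [cks] from degenerating: on a zero integral its division would return 0. *)
Lemma nu_int_cos_gt0 :
  (0 < nu_int sigma s (fun y => ((1 - cos (dotp e y)) ^+ (2 * n.+1))%:E))%E.
Proof.
have [del /andP[d0 d1] Edel] := sigma_dotp_gt0.
set E := [set th : 'rV[R]_N | _] in Edel.
have mE : measurable (E : set (@RN R N)) by exact: dotp_gt_measurable.
have mS := @sphere_measurable R N.
have ES : (0 < sigma (E `&` @sphere R N))%E.
  apply: lt_le_trans Edel _.
  rewrite -[leRHS]adde0 -[X in (_ <= _ + X)%E]sigmaC.
  apply: (@le_trans _ _ (sigma ((E `&` @sphere R N) `|` (~` @sphere R N)))); last first.
    by apply: measureU2; [exact: measurableI|exact: measurableC].
  apply: le_measure; rewrite ?inE//.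
    by apply: measurableU; [exact: measurableI|exact: measurableC].
  by move=> th Eth; have [Sth|Sth] := pselect (@sphere R N th); [left|right].
(* For [r] in [[1, 2]] and a unit vector [th] in [E], [r * |e.th|] lies in [[del, 2]], inside
   [[0, pi]] where [cos] decreases, and the negative power of [r] is smallest at 2. *)
pose kap : R := (1 - cos del) ^+ (2 * n.+1) * 2 `^ (- 1 - 2 * s).
have del_pi : del \in `[0, pi].
  by rewrite in_itv/= ltW//=; have := @pihalf_ge1 R; lra.
have kap0 : 0 < kap.
  rewrite mulr_gt0 ?powR_gt0// exprn_gt0// subr_gt0 -cos0 ltr_cos//.
  by rewrite in_itv/= lexx pi_ge0.
have sge := s_gt0.
have fES : sigma (E `&` @sphere R N) \is a fin_num.
  rewrite ge0_fin_numE//; apply: (@le_lt_trans _ _ 1%E); last exact: ltry.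
  by rewrite -sigmaT; apply: le_measure; rewrite ?inE//; exact: measurableI.
suff H : ((fine (kap%:E * sigma (E `&` @sphere R N)))%:E *
  (@lebesgue_measure R) `[1%R, 2%R]%classic <= nu_int sigma s
  (fun y => ((1 - cos (dotp e y)) ^+ (2 * n.+1))%:E))%E.
  apply: lt_le_trans H.
  rewrite fineK ?fin_numM//.
  rewrite lebesgue_measure_itv/= lte_fin ltr1n/= -EFinB.
  by rewrite mule_gt0 ?mule_gt0// lte_fin; lra.
have k0 (z : R) : (0 <= ((1 - cos z) ^+ (2 * n.+1))%:E)%E.
  by rewrite lee_fin exprn_ge0// oneBcos_ge0.
apply: integral_ge_cst => //.
- by move=> r /=; rewrite !in_itv/= andbT => /andP[r1 _]; exact: lt_le_trans r1.
- by rewrite fine_ge0// mule_ge0// lee_fin ltW.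
- by move=> r _; apply: integral_ge0 => th _; rewrite mule_ge0// lee_fin powR_ge0.
move=> r /=; rewrite in_itv/= => /andP[r1 r2].
rewrite fineK ?fin_numM//.
apply: integral_ge_cst => //.
- exact: measurableI.
- exact: ltW.
- by move=> th _; rewrite mule_ge0// lee_fin powR_ge0.
move=> th [Eth Sth]; rewrite -EFinM lee_fin /kap.
have r0 : 0 < r by lra.
apply: ler_pM; rewrite ?exprn_ge0 ?powR_ge0 ?oneBcos_ge0//.
  apply: lerXn2r; rewrite ?nnegrE ?oneBcos_ge0//.
  rewrite lerB// dotpZr.
  have := dotp_le1 _ _ e_sphere Sth; move: Eth; rewrite /E/=.
  set y := dotp e th => Eth y1.
  have -> : cos (r * y) = cos (r * `|y|).
    have [y0|y0] := leP 0 y; first by rewrite ger0_norm.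
    by rewrite ltr0_norm// mulrN cosN.
  have ry : del <= r * `|y| <= 2 by apply/andP; split; nra.
  have /andP[ry1 ry2] := ry.
  have [<-//|ne] := eqVneq del (r * `|y|).
  apply: ltW; rewrite ltr_cos//; first by rewrite lt_neqAle ne.
  rewrite in_itv/= (le_trans _ ry1) ?(ltW d0)//=.
  by apply: le_trans ry2 _; have := @pihalf_ge1 R; lra.
have -> : - 1 - 2 * s = - (1 + 2 * s) by ring.
rewrite !powRN lef_pV2 ?posrE ?powR_gt0//.
by apply: ge0_ler_powR; rewrite ?nnegrE ?(ltW r0)//; lra.
Qed.

End NormalizingConstant.

(** * Lower bound for the energy of an isolated bump *)

Section EnergyLowerBound.
Context {R : realType} {N : nat}.
Implicit Types (u : 'rV[R]_N -> R) (x y th : 'rV[R]_N).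

Lemma s1E (n : nat) (s : R) : n%:R <= s < n.+1%:R -> s1 s = n.+1.
Proof. by move=> h; rewrite /s1; congr S; apply/truncn_def. Qed.

Lemma nu_int_ge0 (sigma : {measure set (@RN R N) -> \bar R}) (s : R) (g : 'rV[R]_N -> \bar R) :
  (forall y, (0 <= g y)%E) -> (0 <= nu_int sigma s g)%E.
Proof.
move=> g0; apply: integral_ge0 => r _; apply: integral_ge0 => th _.
by rewrite mule_ge0// lee_fin powR_ge0.
Qed.

(** The upper bound on the integral becomes a lower bound on its inverse that depends on [n] alone;
    since the integral is also positive and finite, neither [fine] nor the inverse takes its default
    value. *)
Lemma cks_ge (sigma : {measure set (@RN R N) -> \bar R}) (n : nat) (s : R) (e : 'rV[R]_N) :
  sigma setT = 1%E -> sigma (~` @sphere R N) = 0%E ->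
  (0 < n)%N -> n%:R <= s < n.+1%:R -> @sphere R N e -> (0 < Mfun s sigma e)%E ->
  2 / (2 ^+ (2 * n.+1) * (2 ^+ (2 * n.+1).+1 * (pi / 2))) <= cks sigma e (2 * n.+1) s.
Proof.
move=> sT sC n0 ns eS M0; rewrite /cks.
have lb := nu_int_cos_gt0 _ _ _ _ sT sC n0 ns eS M0.
have ub := nu_int_cos_le _ _ _ _ sT sC n0 ns eS.
move: lb ub; move: (2 * n.+1)%N => k.
case: nu_int => [D| |]; rewrite ?leye_eq// lte_fin lee_fin => D0 DC.
have p2 (m : nat) : 0 < 2 ^+ m :> R by exact: exprn_gt0.
have pp : 0 < pi / 2 :> R by rewrite divr_gt0// pi_gt0.
rewrite ler_pM2l// lef_pV2 ?posrE.
- by rewrite (ler_pM2l (p2 _)).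
- exact: mulr_gt0 (p2 _) (mulr_gt0 (p2 _) pp).
- exact: mulr_gt0 (p2 _) D0.
Qed.

Lemma cks_ge0 (sigma : {measure set (@RN R N) -> \bar R}) (k : nat) (s : R) e :
  0 <= cks sigma e k s.
Proof.
rewrite /cks divr_ge0// mulr_ge0 ?exprn_ge0// fine_ge0//; apply: nu_int_ge0 => y.
by rewrite lee_fin exprn_ge0// oneBcos_ge0.
Qed.

Lemma Eform_ge0 (sigma : R -> {measure set (@RN R N) -> \bar R}) e s u :
  (0 <= Eform sigma e s u)%E.
Proof.
rewrite /Eform; case: eqP => _.
  by apply: iint_ge0 => x; rewrite lee_fin sqr_ge0.
apply: mule_ge0; first by rewrite lee_fin divr_ge0// cks_ge0.
by apply: nu_int_ge0 => y; apply: iint_ge0 => x; rewrite lee_fin sqr_ge0.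
Qed.

Lemma delta_isolated (m : nat) u x y :
  (forall j : int, j != 0 -> `|j| <= m%:Z -> u (x + j%:~R *: y) = 0) ->
  delta m u x y = ('C(2 * m, m))%:R * u x.
Proof.
move=> u0; rewrite /delta big_mkord.
(* Index [m] of the sum is the shift [j = 0]. *)
have mlt : (m < (2 * m).+1)%N by lia.
rewrite (bigD1 (Ordinal mlt))//= big1 ?addr0; last first.
  move=> i im; rewrite u0 ?mulr0//.
    by apply: contra im; rewrite subr_eq0 => /eqP[im]; apply/eqP/val_inj.
  by have := ltn_ord i; lia.
by rewrite subrr expr0z mul1r mulr0z scale0r addr0 mul2n -addnn addnK.
Qed.

Lemma sphere_coord_le1 th : @sphere R N th -> forall i, `|th 0 i| <= 1.
Proof.
rewrite /sphere/= /dotp => thS i.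
rewrite -(@ler_pXn2r _ 2)// ?nnegrE// expr1n real_normK ?num_real//.
rewrite -thS (bigD1 i)//= expr2 lerDl.
by apply: sumr_ge0 => j _; rewrite -expr2 sqr_ge0.
Qed.

(** If all coordinates were below [1/N] in absolute value, the squared norm would be less than
    [1/N]. One large coordinate is enough to make a product of one-variable bumps vanish. *)
Lemma sphere_coord_ge th : @sphere R N th -> exists i, 1 <= N%:R * `|th 0 i|.
Proof.
rewrite /sphere/= /dotp => thS; apply: contrapT => H.
have {}H i : N%:R * `|th 0 i| < 1 by rewrite ltNge; apply/negP => h; apply: H; exists i.
have [N0|N0] := posnP N.
  move: thS; rewrite big1 => [/eqP|i _]; first by rewrite eq_sym oner_eq0.
  by have := ltn_ord i; rewrite {2}N0 ltn0.
have N1 : 1 <= N%:R :> R by rewrite ler1n.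
suff : N%:R ^+ 2 * \sum_(i < N) th 0 i * th 0 i < N%:R * 1.
  by rewrite thS; nra.
rewrite mulr_sumr mulr1 -[X in _ < X%:R]card_ord -sumr_const.
apply: ltr_sum => [|i _]; first by apply/hasP; exists (Ordinal N0); rewrite ?mem_index_enum.
have := H i; set y := th 0 i => yN.
rewrite -expr2 -exprMn -real_normK ?num_real// normrM normr_nat.
have y0 : 0 <= N%:R * `|y| by rewrite mulr_ge0.
nra.
Qed.

(** Integrate over [r] in [[2Nb, 3Nb]] and over [x] in a cube of side [b/2]. For [j] nonzero some
    coordinate of [j r th] has size at least [2b], and all are at most [(n+1) 3Nb], so only the
    central term of the difference survives, with a coefficient at least 1. The factors bound from
    below, in order, [cks / 2], the squared difference, the volume of the cube, [r^(-1-2s)] and the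
    length of the radial interval. *)
Lemma Eform_bump_ge (sigma : R -> {measure set (@RN R N) -> \bar R}) (e : R -> 'rV[R]_N)
    (n : nat) (s : R) u (a b v : R) :
  (0 < N)%N -> sigma s setT = 1%E -> sigma s (~` @sphere R N) = 0%E ->
  (0 < n)%N -> n%:R <= s < n.+1%:R -> @sphere R N (e s) ->
  (0 < Mfun s (sigma s) (e s))%E ->
  0 < b -> 3 * N%:R * b <= 1 -> 0 <= v ->
  (forall x, (forall i, a + b / 4 <= x 0 i <= a + 3 * b / 4) -> v <= u x) ->
  (forall x (z : 'rV[R]_N), (forall i, a + b / 4 <= x 0 i <= a + 3 * b / 4) ->
    (exists i, 2 * b <= `|z 0 i - x 0 i|) ->
    (forall i, `|z 0 i - x 0 i| <= n.+1%:R * (3 * N%:R * b)) -> u z = 0) ->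
  ((1 / (2 ^+ (2 * n.+1) * (2 ^+ (2 * n.+1).+1 * (pi / 2))) *
    (v ^+ 2 * (b / 2) ^+ N * (3 * N%:R * b) ^- (2 * n).+1 * (N%:R * b)))%:E
    <= Eform sigma e s u)%E.
Proof.
move=> N0 sT sC n0 ns eS M0 b0 b1 v0 vu uz.
have /andP[ns1 ns2] := ns.
have n1 : 1 <= n%:R :> R by rewrite ler1n.
have N1 : 1 <= N%:R :> R by rewrite ler1n.
rewrite /Eform ifF; last by apply/eqP; lra.
rewrite (s1E _ _ ns) EFinM; apply: lee_pmul.
- rewrite lee_fin; apply: divr_ge0 => //; do 2 (apply: mulr_ge0; first exact: exprn_ge0).
  by rewrite divr_ge0// pi_ge0.
- rewrite lee_fin !mulr_ge0 ?exprn_ge0// ?invr_ge0 ?exprn_ge0 ?mulr_ge0//; lra.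
- rewrite lee_fin ler_pdivlMr//; apply: le_trans (cks_ge _ _ _ _ sT sC n0 ns eS M0).
  by rewrite mulrAC mul1r.
have -> : N%:R * b = 3 * N%:R * b - 2 * N%:R * b by ring.
have Nb0 : 0 < N%:R * b by rewrite mulr_gt0//; lra.
rewrite [X in (X <= _)%E]EFinM.
have -> : (3 * N%:R * b - 2 * N%:R * b)%:E =
    (@lebesgue_measure R) `[2 * N%:R * b, 3 * N%:R * b]%classic.
  by rewrite lebesgue_measure_itv/= lte_fin ifT//; lra.
have g0 y : (0 <= iint (fun x => (delta n.+1 u x y ^+ 2)%:E))%E.
  by apply: iint_ge0 => x; rewrite lee_fin sqr_ge0.
apply: integral_ge_cst => //.
- by move=> r /=; rewrite !in_itv/= andbT => /andP[r1 _]; lra.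
- rewrite !mulr_ge0 ?exprn_ge0// ?invr_ge0 ?exprn_ge0 ?mulr_ge0//; lra.
- by move=> r _; apply: integral_ge0 => th _; rewrite mule_ge0// lee_fin powR_ge0.
move=> r /=; rewrite in_itv/= => /andP[r1 r2].
have r0 : 0 < r by lra.
(* The factor 1 is rewritten as the mass of the sphere, so that the inner bound is required for unit
   vectors only. *)
rewrite -[X in (X <= _)%E]mule1 -{1}sT -[in X in (_ * X)%E](setUv (@sphere R N)).
have -> : sigma s (@sphere R N `|` ~` @sphere R N) = sigma s (@sphere R N).
  by rewrite measureU0//; [exact: sphere_measurable|exact: measurableC sphere_measurable].
apply: integral_ge_cst => //.
- exact: sphere_measurable.
- rewrite !mulr_ge0 ?exprn_ge0// ?invr_ge0 ?exprn_ge0 ?mulr_ge0//; lra.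
- by move=> th _; rewrite mule_ge0// lee_fin powR_ge0.
move=> th Sth; rewrite EFinM; apply: lee_pmul.
- by rewrite lee_fin mulr_ge0 ?exprn_ge0// divr_ge0// ltW.
- by rewrite lee_fin invr_ge0 exprn_ge0//; lra.
- have -> : b / 2 = (a + 3 * b / 4) - (a + b / 4) by field.
  apply: iint_ge_box; [lra|exact: sqr_ge0| |].
    by move=> x; rewrite lee_fin sqr_ge0.
  move=> x xb; rewrite lee_fin delta_isolated.
    apply: lerXn2r; rewrite ?nnegrE//.
      by rewrite mulr_ge0// (le_trans v0 (vu _ xb)).
    apply: le_trans (vu _ xb) _; rewrite ler_peMl ?(le_trans v0 (vu _ xb))//.
    by rewrite ler1n bin_gt0; lia.
  move=> j j0 jm; apply: (uz x) => //.
    have [i hi] := sphere_coord_ge _ Sth; exists i.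
    rewrite !mxE addrAC subrr add0r !normrM (ger0_norm (ltW r0)).
    have j1 : 1 <= `|j%:~R : R|.
      by rewrite -intr_norm ler1z; lia.
    have t0 := normr_ge0 (th 0 i).
    have rt : 2 * b <= r * `|th 0 i|.
      apply: (@le_trans _ _ (2 * N%:R * b * `|th 0 i|)); last by rewrite ler_wpM2r.
      by nra.
    by apply: le_trans rt _; rewrite ler_peMl// mulr_ge0// ltW.
  move=> i; rewrite !mxE addrAC subrr add0r !normrM (ger0_norm (ltW r0)).
  have := sphere_coord_le1 _ Sth i.
  have j1 : `|j%:~R : R| <= n.+1%:R.
    by rewrite -intr_norm -[n.+1%:R]/(n.+1%:Z%:~R) ler_int.
  move=> t1; apply: ler_pM => //; first by rewrite mulr_ge0// ltW.
  apply: le_trans r2; rewrite -[leRHS]mulr1; apply: ler_pM => //; exact: ltW.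
- rewrite lee_fin.
  (* From [r <= 3Nb <= 1] and [s >= n]: [r^(-1-2s) >= r^-(2n+1) >= (3Nb)^-(2n+1)]. *)
  apply: (@le_trans _ _ (r ^- (2 * n).+1)).
    rewrite lef_pV2 ?posrE ?exprn_gt0//; last lra.
    by apply: lerXn2r; rewrite ?nnegrE//; lra.
  rewrite -powR_invn ?(ltW r0)//; apply: ger_powR; first by rewrite r0; lra.
  by rewrite -!natr1 natrM; lra.
Qed.

End EnergyLowerBound.

(** * Smooth functions on the line and a compactly supported bump *)

Section SmoothLine.
Context {R : realType}.
Implicit Types f g : R -> R.

Lemma near_gt (x a : R) : a < x -> \forall y \near x, a < y.
Proof. by rewrite -ltrN2 => /Nlt_nbhsl; apply: filterS => y; rewrite ltrN2. Qed.

Lemma near_lt (x a : R) : x < a -> \forall y \near x, y < a.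
Proof. exact: lt_nbhsl. Qed.

(** The difference quotient at 0 is at most [C |t|]. This handles the point 0 both for [flat] and
    for the accumulating sum of bumps. *)
Lemma is_derive_quadratic_contact f (C : R) :
  f 0 = 0 -> (\forall t \near (0 : R), `|f t| <= C * t ^+ 2) -> is_derive (0 : R) 1 f 0.
Proof.
move=> f0 fC.
have H : (fun h : R => h^-1 * (f (h * 1 + 0) - f 0)) @ 0^' --> (0 : R).
  apply/cvgr0Pnorm_le => eps eps0.
  have C1 : 0 < `|C| + 1 by rewrite ltr_wpDl.
  have : \forall h \near (0 : R), `|h| <= eps / (`|C| + 1).
    near=> h; rewrite ltW//; near: h.
    apply: (@cvgr0_norm_lt R R); first exact: cvg_id.
    by rewrite divr_gt0.
  move=> he.
  near=> h => /=.
  rewrite addr0 f0 subr0 mulr1.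
  have h0 : h != 0 by near: h; exact: nbhs_dnbhs_neq.
  have hC : `|f h| <= C * h ^+ 2 by near: h; exact: nbhs_dnbhs.
  have hh : `|h| <= eps / (`|C| + 1) by near: h; exact: nbhs_dnbhs.
  rewrite normrM normfV ler_pdivrMl ?normr_gt0//.
  apply: le_trans hC _; rewrite -[h ^+ 2]real_normK ?num_real// expr2 mulrCA.
  rewrite ler_wpM2l//.
  move: hh; rewrite ler_pdivlMr// => hh; apply: le_trans hh.
  rewrite mulrC ler_wpM2l//; have := ler_norm C; lra.
split; first by apply/cvg_ex; exists 0.
by rewrite /derive; apply/cvg_lim.
Unshelve. all: by end_near. Qed.

(** Recursion on the derivative lets closure under sums, products and reflections go by induction on
    [n]. *)
Fixpoint diffn (n : nat) f : Prop :=
  if n is n'.+1 then (forall x : R, derivable f x 1) /\ diffn n' (derive1 f) else True.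

Lemma diffnS n f g : (forall x : R, is_derive x 1 f (g x)) -> diffn n g -> diffn n.+1 f.
Proof.
move=> fg gn; split=> [x|]; first by have [] := fg x.
suff -> : (derive1 f) = g by [].
by apply/funext => x; rewrite derive1E; have [] := fg x.
Qed.

Lemma diffnW n f : diffn n.+1 f -> diffn n f.
Proof. by elim: n f => [//|n IH] f [df /IH]. Qed.

Lemma diffn_is_derive n f (x : R) : diffn n.+1 f -> is_derive x 1 f ((derive1 f) x).
Proof. by move=> [df _]; rewrite derive1E; exact: derivableP. Qed.

Lemma diffn_cst n (c : R) : diffn n (cst c).
Proof.
elim: n c => [//|n IH] c; apply: (@diffnS _ _ (cst 0)); exact: IH.
Qed.

Lemma diffnD n f g : diffn n f -> diffn n g -> diffn n (fun x => f x + g x).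
Proof.
elim: n f g => [//|n IH] f g fn gn.
apply: (@diffnS _ _ (fun x => (derive1 f) x + (derive1 g) x)) => [x|].
  exact: is_deriveD (diffn_is_derive _ _ _ fn) (diffn_is_derive _ _ _ gn).
by apply: IH; [case: fn|case: gn].
Qed.

Lemma diffnM n f g : diffn n f -> diffn n g -> diffn n (fun x => f x * g x).
Proof.
elim: n f g => [//|n IH] f g fn gn.
apply: (@diffnS _ _ (fun x => f x * (derive1 g) x + g x * (derive1 f) x)) => [x|].
  exact: is_deriveM (diffn_is_derive _ _ _ fn) (diffn_is_derive _ _ _ gn).
by apply: diffnD; apply: IH; try exact: diffnW; [case: gn|case: fn].
Qed.

Lemma diffn_reflect n f (c : R) : diffn n f -> diffn n (fun x => f (c - x)).
Proof.
elim: n f => [//|n IH] f fn.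
apply: (@diffnS _ _ (fun x => - 1 * (derive1 f) (c - x))) => [x|].
  have h : is_derive x 1 (fun x => c - x) (-1).
    have := @is_deriveB R R R (cst c) id x 1 0 1 _ _.
    by rewrite sub0r; apply.
  have := @is_derive1_comp R f (fun x => c - x) x _ _ (diffn_is_derive _ _ _ fn) h.
  by rewrite mulrC.
apply: diffnM; first exact: diffn_cst.
by apply: IH; case: fn.
Qed.

Lemma diffn_derive1n f : (forall n, diffn n f) -> forall k n, diffn n (derive1n k f).
Proof.
by move=> fn; elim=> [//|k IH] n; rewrite derive1nS; have [] := IH n.+1.
Qed.

Lemma diffn_derive1nE f k (x : R) : (forall n, diffn n f) ->
  is_derive x 1 (derive1n k f) ((derive1n (k.+1) f) x).
Proof.
by move=> fn; rewrite derive1nS; apply: (diffn_is_derive 0); exact: diffn_derive1n.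
Qed.

Lemma derive1n_eq0 f (k : nat) (A : set R) : open A ->
  (forall x, A x -> f x = 0) -> forall x, A x -> (derive1n k f) x = 0.
Proof.
move=> oA f0; elim: k => [//|k IH] x Ax; rewrite derive1nS derive1E.
have -> : 'D_1 (derive1n k f) x = 'D_1 (cst 0 : R -> R) x.
  by apply: near_eq_derive; apply: filterS (open_nbhs_nbhs (conj oA Ax)) => y /IH.
exact: derive_cst.
Qed.

(* The derivatives of [exp(-1/t)] are combinations of the functions [t^-j * exp(-1/t)]. *)
Definition flat (j : nat) (t : R) : R :=
  if 0 < t then t^-1 ^+ j * expR (- t^-1) else 0.

Lemma flat_ge0 j t : 0 <= flat j t.
Proof.
rewrite /flat; case: ifPn => // t0.
by rewrite mulr_ge0 ?expR_ge0// exprn_ge0// invr_ge0 ltW.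
Qed.

(** With [z = 1/t] the claim is [z^(j+2) <= (j+2)! exp z], one term of the exponential series. *)
Lemma flat_le_sqr j t : `|flat j t| <= (j.+2)`!%:R * t ^+ 2.
Proof.
rewrite ger0_norm ?flat_ge0// /flat; case: ifPn => [t0|_]; last first.
  by rewrite mulr_ge0// sqr_ge0.
have z0 : 0 < t^-1 by rewrite invr_gt0.
rewrite -[X in _ <= _ * X ^+ 2]invrK.
move: (t^-1) z0 => z z0.
have f0 : 0 < (j.+2)`!%:R :> R by rewrite ltr0n fact_gt0.
have hz : z ^+ j.+2 <= (j.+2)`!%:R * expR z.
  rewrite mulrC -ler_pdivrMr//.
  by have := @expR_ge1Dxn R z j.+1 (ltW z0); lra.
rewrite expRN exprVn ler_pdivrMr ?expR_gt0// mulrAC ler_pdivlMr ?exprn_gt0//.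
by rewrite -exprD addn2.
Qed.

Lemma is_derive_flat j (x : R) :
  is_derive x 1 (flat j) (- j%:R * flat j.+1 x + flat j.+2 x).
Proof.
have [x0|x0|->] := ltgtP x 0.
- rewrite /flat !ifF ?(lt_gtF x0)// mulr0 addr0.
  apply: (@near_eq_is_derive R R R (cst 0)).
  near=> y; have : y < 0 by near: y; exact: near_lt.
  by move=> y0; rewrite /flat ifF// (lt_gtF y0).
- rewrite /flat !ifT//.
  apply: (@near_eq_is_derive R R R (fun t : R => t^-1 ^+ j * expR (- t^-1))).
    by near=> y; have y0 : 0 < y by [near: y; exact: near_gt]; rewrite /flat y0.
  have xn0 : x != 0 by rewrite gt_eqF.
  have dV : is_derive x 1 (fun t : R => t^-1) (- x ^- 2).
    have := @is_deriveV R id x 1 1 xn0 _.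
    by rewrite /GRing.scale/= mulr1; apply.
  have dE : is_derive x 1 (fun t : R => expR (- t^-1)) (x ^- 2 * expR (- x^-1)).
    have := @is_derive1_comp R expR (fun t => - t^-1) x _ _ (is_derive_expR _) (is_deriveN dV).
    by rewrite opprK mulrC.
  have := @is_deriveM _ _ _ _ _ _ _ _ (@is_deriveX _ _ _ j _ _ _ dV) dE.
  rewrite /GRing.scale/= => H.
  have fE : (fun t : R => t^-1) ^+ j * (fun t : R => expR (- t^-1)) =
      fun t => t^-1 ^+ j * expR (- t^-1) by apply/funext => t; rewrite !fctE.
  rewrite -fE; apply: (is_derive_eq H).
  rewrite !fctE -!exprVn; move: (expR _) => E.
  case: (j) => [|i] /=; first by ring.
  by rewrite !exprS; ring.
- rewrite /flat !ltxx mulr0 addr0.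
  apply: (@is_derive_quadratic_contact _ (j.+2)`!%:R); first by rewrite ltxx.
  by near=> t; exact: flat_le_sqr.
Unshelve. all: by end_near. Qed.

Lemma diffn_flat n j : diffn n (flat j).
Proof.
elim: n j => [//|n IH] j; apply: diffnS (is_derive_flat j) _.
by apply: diffnD => //; apply: diffnM => //; exact: diffn_cst.
Qed.

Definition bump (t : R) : R := flat 0 t * flat 0 (1 - t).

Lemma diffn_bump n : diffn n bump.
Proof. by apply: diffnM; [|apply: diffn_reflect]; exact: diffn_flat. Qed.

Lemma bump_out t : t < 0 \/ 1 < t -> bump t = 0.
Proof.
rewrite /bump /flat => -[t0|t1].
  by rewrite ifF ?mul0r// (lt_gtF t0).
by rewrite [X in _ * X]ifF ?mulr0//; apply/negbTE; rewrite -leNgt; lra.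
Qed.

Lemma bump_ge t : 4^-1 <= t <= 3 / 4 -> expR (- 8) <= bump t.
Proof.
have H x : 4^-1 <= x -> expR (- 4) <= flat 0 x.
  move=> x4; rewrite /flat ifT; last lra.
  rewrite expr0 mul1r ler_expR lerN2 -[leRHS]invrK lef_pV2 ?posrE//; lra.
move=> /andP[t1 t2]; have -> : (- 8 : R) = - 4 + - 4 by ring.
by rewrite expRD; apply: ler_pM; rewrite ?expR_ge0//; apply: H; lra.
Qed.

Lemma derive1n_bump_out k t : t < 0 \/ 1 < t -> (derive1n k bump) t = 0.
Proof.
apply: (@derive1n_eq0 _ _ (fun t => t < 0 \/ 1 < t)); last exact: bump_out.
rewrite (_ : (fun _ => _) = (`]-oo, 0[%classic `|` `]1, +oo[%classic)).
  by apply: openU; exact: interval_open.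
by apply/seteqP; split => x /=; rewrite !in_itv/= andbT.
Qed.

Lemma derive1n_bump_bounded k : exists2 C, 0 < C & forall t, `|(derive1n k bump) t| <= C.
Proof.
have cont : {within `[0, 1], continuous (fun t : R => `|(derive1n k bump) t|)}.
  apply: continuous_subspaceT => x; apply: continuous_comp; last exact: norm_continuous.
  apply: differentiable_continuous; apply/derivable1_diffP.
  by have [] := diffn_derive1nE _ k x diffn_bump.
have [c _ cmax] := EVT_max ler01 cont.
exists (`|(derive1n k bump) c| + 1); first by rewrite ltr_wpDl.
move=> t; have [t01|t01] := boolP (t \in `[0, 1]).
  by apply: le_trans (cmax _ t01) _; rewrite lerDl.
rewrite derive1n_bump_out ?normr0 ?addr_ge0//.
move: t01; rewrite in_itv/= negb_and -!ltNge => /orP[]; [by left|by right].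
Qed.

End SmoothLine.

(** * Infinite sum of bumps accumulating at 0 *)

Section AccumulatingBumps.
Context {R : realType}.
Variables (a b amp : nat -> R).
Hypotheses (b_gt0 : forall n, 0 < b n) (a_gt0 : forall n, 0 < a n).
Hypothesis a_dec : forall m n, (m <= n)%N -> a n <= a m.
Hypothesis ab_le : forall n, a n + b n <= n.+1%:R^-1.

(** This is the [k]-th derivative of the rescaled bump [amp n * bump ((t - a n) / b n)]; all orders
    are carried together so that differentiating only raises [k]. *)
Definition sbump (n k : nat) (t : R) : R :=
  amp n * b n ^- k * derive1n k bump ((t - a n) / b n).

Hypothesis sbump_small : forall k, exists n0, forall n, (n0 <= n)%N ->
  forall t, `|sbump n k t| <= 2 ^- n * t ^+ 2.

(** The truncated sum is the whole series: for [t > 0] and [n > 1/t], bump [n] ends by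
    [1/(n+1) < t], and for [t <= 0] all terms vanish. *)
Definition bumps (k : nat) (t : R) : R := \sum_(n < (Num.truncn t^-1).+1) sbump n k t.

Lemma sbump_out n k t : t < a n \/ a n + b n < t -> sbump n k t = 0.
Proof.
move=> h; rewrite /sbump derive1n_bump_out ?mulr0//.
by case: h => h; [left|right]; rewrite ?ltr_pdivrMr ?ltr_pdivlMr// ?mul0r ?mul1r; lra.
Qed.

Lemma is_derive_sbump n k (x : R) : is_derive x 1 (sbump n k) (sbump n k.+1 x).
Proof.
have bn : b n != 0 by rewrite gt_eqF.
have h : is_derive x 1 (fun t : R => (t - a n) / b n) (b n)^-1.
  have H := is_deriveZ (b n)^-1 (@is_deriveB R R R id (cst (a n)) x 1 1 0 _ _).
  have -> : (fun t : R => (t - a n) / b n) = (b n)^-1 \*: (id - cst (a n)).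
    by apply/funext => t; rewrite mulrC.
  by apply: (is_derive_eq (H _ _)); rewrite /GRing.scale/= subr0 mulr1.
have dB := @diffn_derive1nE R bump k ((x - a n) / b n) diffn_bump.
have dC := @is_derive1_comp R (derive1n k bump) (fun t : R => (t - a n) / b n) x _ _ dB h.
rewrite /sbump exprS invfM; move: dC; move: (derive1n k.+1 bump _) => D dC.
apply: (is_derive_eq (is_deriveZ (amp n * b n ^- k) dC)).
by rewrite /GRing.scale/=; ring.
Qed.

Lemma sum_sbump_stable k t M M' : (t <= 0 \/ t^-1 <= M%:R) -> (M <= M')%N ->
  \sum_(n < M') sbump n k t = \sum_(n < M) sbump n k t.
Proof.
move=> tM MM'; rewrite -(big_mkord xpredT (fun n => sbump n k t)) (big_cat_nat (leq0n M) MM')/=.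
rewrite big_mkord [X in _ + X]big_nat_cond [X in _ + X]big1 ?addr0// => n /andP[/andP[Mn _] _].
apply: sbump_out; have [t0|t0] := leP t 0; first by left; exact: le_lt_trans t0 _.
right; apply: le_lt_trans (ab_le n) _.
case: tM => [|tM]; first by rewrite leNgt t0.
rewrite -[ltRHS]invrK ltf_pV2 ?posrE ?invr_gt0 ?ltr0n//.
apply: le_lt_trans tM _; by rewrite ltr_nat ltnS.
Qed.

Lemma bumpsE k t M : (t <= 0 \/ t^-1 <= M%:R) ->
  bumps k t = \sum_(n < M) sbump n k t.
Proof.
move=> tM; rewrite /bumps.
have tT : t <= 0 \/ t^-1 <= (Num.truncn t^-1).+1%:R.
  by right; apply: ltW; exact: truncnS_gt.
by have [h|/ltnW h] := leqP M (Num.truncn t^-1).+1; [|symmetry]; exact: sum_sbump_stable.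
Qed.

Lemma bumps_out k t : t < 0 \/ (forall n, a n + b n < t) -> bumps k t = 0.
Proof.
move=> h; rewrite /bumps big1// => n _; apply: sbump_out.
by case: h => [t0|]; [left; exact: lt_trans t0 _|right].
Qed.

Lemma bumps_single k t n :
  (forall m, m != n -> t < a m \/ a m + b m < t) -> bumps k t = sbump n k t.
Proof.
move=> h; rewrite (@bumpsE _ _ (maxn n.+1 (Num.truncn t^-1).+1)); last first.
  right; apply: le_trans (ltW (truncnS_gt _)) _.
  by rewrite ler_nat leq_max leqnn orbT.
have nM : (n < maxn n.+1 (Num.truncn t^-1).+1)%N by rewrite leq_max leqnn.
rewrite (bigD1 (Ordinal nM))//= big1 ?addr0// => m mn.
by apply: sbump_out; apply: h; apply: contra mn => /eqP mn; apply/eqP/val_inj.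
Qed.

(** Near a nonzero point one finite sum represents [bumps]. At 0, for [t < a n0] only the bumps with
    [n >= n0] contribute, and [sbump_small] bounds them by a geometric series times [t^2]: quadratic
    contact. *)
Lemma is_derive_bumps k (x : R) : is_derive x 1 (bumps k) (bumps k.+1 x).
Proof.
have step M : (\forall y \near x, y <= 0 \/ y^-1 <= M%:R) -> is_derive x 1 (bumps k) (bumps k.+1 x).
  move=> h; rewrite (bumpsE _ _ _ (nbhs_singleton h)).
  apply: (@near_eq_is_derive R R R (\sum_(n < M) sbump n k)).
    by apply: filterS h => y hy; rewrite (bumpsE _ _ _ hy) fct_sumE.
  by apply: is_derive_sum => n; exact: is_derive_sbump.
have [x0|x0|->] := ltgtP x 0.
- by apply: (step 0%N); apply: filterS (near_lt _ _ x0) => y /ltW; left.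
(* For [y > x/2] one has [1/y < 2/x], so the same number of terms serves a neighbourhood of [x]. *)
- apply: (step (Num.truncn (x / 2)^-1).+1).
  have x2 : x / 2 < x by lra.
  apply: filterS (near_gt _ _ x2) => y y0; right.
  apply: le_trans (ltW (truncnS_gt _)); rewrite lef_pV2 ?posrE//; lra.
- rewrite (bumpsE _ _ 0%N) ?big_ord0; last by left.
  have [n0 hn0] := sbump_small k.
  apply: (@is_derive_quadratic_contact _ _ 2).
    by rewrite (bumpsE _ _ 0%N) ?big_ord0; [|left].
  apply: filterS (near_lt _ _ (a_gt0 n0)) => t ta; rewrite /bumps.
  move: (Num.truncn _).+1 => M.
  apply: le_trans (ler_norm_sum _ _ _) _.
  apply: (@le_trans _ _ (\sum_(n < M) 2 ^- n * t ^+ 2)).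
    apply: ler_sum => n _; have [h|h] := leqP n0 n; first exact: hn0.
    rewrite sbump_out ?normr0; first by rewrite mulr_ge0 ?sqr_ge0// invr_ge0 exprn_ge0.
    by left; apply: lt_le_trans ta _; apply: a_dec; exact: ltnW.
  rewrite -mulr_suml ler_wpM2r ?sqr_ge0//.
  have -> : \sum_(n < M) 2 ^- n = 2 - 2 * 2 ^- M :> R.
    elim: M => [|M IH]; first by rewrite big_ord0 expr0 invr1; ring.
    by rewrite big_ord_recr /= IH exprS invfM; field.
  by rewrite gerBl mulr_ge0// invr_ge0 exprn_ge0.
Qed.

End AccumulatingBumps.

(** * Smoothness of products of one-variable functions *)

Section CoordinateFunctions.
Context {R : realType} {N : nat}.
Variable W : nat -> R -> R.
Hypothesis W_derive : forall k (x : R), is_derive x 1 (W k) (W k.+1 x).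

(** The class is stable under directional derivatives and its members are differentiable, so
    iterated derivatives never leave it and no mixed partial has to be computed. *)
Inductive coord_algebra : ('rV[R]_N -> R) -> Prop :=
| coord_fun (i : 'I_N) (k : nat) : coord_algebra (fun x => W k (x 0 i))
| coord_cst (c : R) : coord_algebra (cst c)
| coord_add f g : coord_algebra f -> coord_algebra g -> coord_algebra (f + g)
| coord_mul f g : coord_algebra f -> coord_algebra g -> coord_algebra (f * g).

Lemma differentiable_coordinate (i : 'I_N) (x : 'rV[R]_N) :
  differentiable (fun y : 'rV[R]_N => y 0 i : R) x.
Proof. exact: differentiable_coord. Qed.

Lemma diff_coordinate (i : 'I_N) (x v : 'rV[R]_N) :
  'd (fun y : 'rV[R]_N => y 0 i : R) x v = v 0 i.
Proof.
(* The coordinate is packed as a linear map, which is its own differential. *)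
have @f : {linear 'rV[R]_N -> R}.
  by exists (fun y : 'rV[R]_N => y 0 i); do 2![eexists]; do ?[constructor];
     rewrite ?mxE// => ? *; rewrite ?mxE//; move=> ?; rewrite !mxE.
rewrite (_ : (fun y : 'rV[R]_N => y 0 i : R) = f) // diff_lin//.
exact: coord_continuous.
Qed.

Lemma coord_algebra_differentiable f : coord_algebra f -> forall x, differentiable f x.
Proof.
elim=> [i k|c|{}f g _ df _ dg|{}f g _ df _ dg] x.
- apply: (@differentiable_comp _ _ _ _ (fun y : 'rV[R]_N => y 0 i : R) (W k)).
    exact: differentiable_coordinate.
  by apply/derivable1_diffP; have [] := W_derive k (x 0 i).
- exact: differentiable_cst.
- exact: differentiableD.
- exact: differentiableM.
Qed.

Lemma coord_algebra_derive f v : coord_algebra f -> coord_algebra (fun x => 'D_v f x).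
Proof.
elim=> [i k|c|{}f g Af df Ag dg|{}f g Af df Ag dg].
- suff -> : (fun x => 'D_v (fun y : 'rV[R]_N => W k (y 0 i)) x) =
      cst (v 0 i) * (fun x => W k.+1 (x 0 i)).
    by apply: coord_mul; [exact: coord_cst|exact: coord_fun].
  apply/funext => x.
  rewrite deriveE; last exact: (coord_algebra_differentiable _ (coord_fun i k)).
  have dW : differentiable (W k) (x 0 i).
    by apply/derivable1_diffP; have [] := W_derive k (x 0 i).
  have -> := @diff_comp _ _ _ _ (fun y : 'rV[R]_N => y 0 i : R) (W k) x
    (differentiable_coordinate i x) dW.
  rewrite /= diff_coordinate diff1E// derive1E.
  by have [_ ->] := W_derive k (x 0 i).
- rewrite (_ : (fun x => _) = cst 0); first exact: coord_cst.
  by apply/funext => x; rewrite derive_cst.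
- rewrite (_ : (fun x => _) = (fun x => 'D_v f x) + (fun x => 'D_v g x)).
    exact: coord_add.
  apply/funext => x; rewrite deriveD//; apply: diff_derivable; exact: coord_algebra_differentiable.
- rewrite (_ : (fun x => _) = f * (fun x => 'D_v g x) + g * (fun x => 'D_v f x)).
    by apply: coord_add; exact: coord_mul.
  apply/funext => x; rewrite deriveM//; apply: diff_derivable; exact: coord_algebra_differentiable.
Qed.

Lemma coord_algebra_smooth f : coord_algebra f -> smooth f.
Proof.
move=> Af vs x; apply: coord_algebra_differentiable.
by elim: vs => [//|v vs IH] /=; exact: coord_algebra_derive.
Qed.

Lemma coord_algebra_prod : coord_algebra (fun x => \prod_(i < N) W 0 (x 0 i)).
Proof.
suff H (s : seq 'I_N) : coord_algebra (fun x => \prod_(i <- s) W 0 (x 0 i)) by exact: H.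
elim: s => [|i s IH].
  rewrite (_ : (fun x => _) = cst 1); first exact: coord_cst.
  by apply/funext => x; rewrite big_nil.
rewrite (_ : (fun x => _) = (fun x : 'rV[R]_N => W 0 (x 0 i)) *
    (fun x : 'rV[R]_N => \prod_(j <- s) W 0 (x 0 j))).
  by apply: coord_mul => //; exact: coord_fun.
by apply/funext => x; rewrite big_cons.
Qed.

Lemma Cc_infty_B1_prod (rho : R) : (0 < N)%N -> rho * (2 * N%:R) = 1 ->
  (forall t, t < 0 \/ rho < t -> W 0 t = 0) ->
  Cc_infty_B1 (fun x => \prod_(i < N) W 0 (x 0 i)).
Proof.
move=> N0 rN W0; split; first exact: coord_algebra_smooth coord_algebra_prod.
(* The support lies in this cube; with [rho = 1/(2N)] its points have squared norm at most
   [N rho^2 = 1/(4N)]. *)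
pose K := [set x : 'rV[R]_N | forall i, `[0, rho]%classic (x 0 i)].
have cK : compact K.
  by apply: (rV_compact (A := fun=> `[0, rho]%classic)) => i; exact: segment_compact.
have sK : closure [set x : 'rV[R]_N | \prod_(i < N) W 0 (x 0 i) != 0] `<=` K.
  have /closure_id -> : closed K by apply: compact_closed cK; exact: norm_hausdorff.
  apply: closureS => x /= /prodf_neq0 xi i.
  rewrite /= in_itv/=; apply: contrapT => h; have := xi i isT; rewrite W0 ?eqxx//.
  by move/negP: h; rewrite negb_and -!ltNge => /orP.
split.
  apply: subclosed_compact cK sK; exact: closed_closure.
apply: subset_trans sK _ => x Kx; rewrite /unit_ball/= /dotp.
apply: (@le_lt_trans _ _ (\sum_(i < N) rho ^+ 2)).
  apply: ler_sum => i _; have := Kx i; rewrite /= in_itv/= => /andP[x0 x1]; nra.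
rewrite sumr_const card_ord -mulr_natl.
have N1 : 1 <= N%:R :> R by rewrite ler1n.
nra.
Qed.

End CoordinateFunctions.

(** * Choice of positions, widths and heights *)

Section BumpParameters.
Context {R : realType}.
Variables (N : nat) (B : nat -> R).
Hypotheses (N_gt0 : (0 < N)%N) (B_gt0 : forall n, 0 < B n).

Let N1 : 1 <= N%:R :> R. Proof. by rewrite ler1n. Qed.

(** The factor [1/(4N)] keeps every bump inside [[0, 1/(2N)]]. *)
Definition loc (n : nat) : R := (4 * N%:R)^-1 / n.+1%:R.
Definition gap (n : nat) : R := (4 * N%:R)^-1 / (n.+1%:R * n.+2%:R).
(** What remains of the bound in [Eform_bump_ge], for [v = (height n * exp(-8))^N], once all powers
    of the width are taken out. *)
Definition energy_cst (n : nat) : R :=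
  (1 / (2 ^+ (2 * n.+1) * (2 ^+ (2 * n.+1).+1 * (pi / 2)))) *
  (expR (- 8) ^+ (2 * N) * 2 ^- N * (3 * N%:R) ^- (2 * n).+1 * N%:R).
(** The three bounds serve in turn to isolate the bump at the scale of the differences, to make the
    tail of the series geometric, and to push the energy above the prescribed level [B n]. *)
Definition width (n : nat) : R :=
  Num.min (Num.min (gap n / (2 * (2 + n.+1%:R * (3 * N%:R)))) (2 ^- n))
    (energy_cst n / B n).
(* [2 * N * order n <= n] makes the energy of the [n]-th bump blow up as its width
   shrinks, while [order n] unbounded keeps all derivatives of the sum finite. *)
Definition order (n : nat) : nat := n %/ (2 * N).
Definition height (n : nat) : R := width n ^+ order n.

Let c_gt0 : 0 < (4 * N%:R)^-1 :> R.
Proof. by rewrite invr_gt0; have := N1; lra. Qed.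

Let c_le : (4 * N%:R)^-1 <= 4^-1 :> R.
Proof. by have := N1 => N1'; rewrite lef_pV2 ?posrE; lra. Qed.

Lemma loc_gt0 n : 0 < loc n.
Proof. by rewrite divr_gt0. Qed.

Lemma gap_gt0 n : 0 < gap n.
Proof. by rewrite divr_gt0// mulr_gt0. Qed.

Lemma loc_dec m n : (m <= n)%N -> loc n <= loc m.
Proof. by move=> mn; rewrite /loc ler_pM2l// lef_pV2 ?posrE// ler_nat ltnS. Qed.

Lemma gap_dec m n : (m <= n)%N -> gap n <= gap m.
Proof.
move=> mn; rewrite /gap ler_pM2l// lef_pV2 ?posrE ?mulr_gt0//.
by apply: ler_pM => //; rewrite ler_nat !ltnS.
Qed.

Lemma loc_gap n : loc n = loc n.+1 + gap n.
Proof.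
rewrite /loc /gap -mulrDr; congr (_ * _).
have h1 : n.+1%:R != 0 :> R by rewrite pnatr_eq0.
have h3 : n.+2%:R = n.+1%:R + 1 :> R by rewrite -natr1.
have h4 : n.+1%:R + 1 != 0 :> R by rewrite -h3.
rewrite h3; move: (n.+1%:R) h1 h4 => p h1 h4; field.
by rewrite h1 h4.
Qed.

Lemma energy_cst_gt0 n : 0 < energy_cst n.
Proof.
have := N1 => N1'; have N0 : 0 < N%:R :> R by lra.
have N3 : 0 < 3 * N%:R :> R by lra.
have p2 m : 0 < 2 ^+ m :> R by exact: exprn_gt0.
have e8 : 0 < expR (- 8) :> R by exact: expR_gt0.
have pp : 0 < pi / 2 :> R by rewrite divr_gt0// pi_gt0.
apply: mulr_gt0; last first.
  apply: mulr_gt0 => //; apply: mulr_gt0; last by rewrite invr_gt0 exprn_gt0.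
  by apply: mulr_gt0; [exact: exprn_gt0|rewrite invr_gt0; exact: p2].
apply: divr_gt0 => //; apply: mulr_gt0; first exact: p2.
by apply: mulr_gt0 => //; exact: p2.
Qed.

Lemma width_gt0 n : 0 < width n.
Proof.
have N3 : 0 <= n.+1%:R * (3 * N%:R) :> R by rewrite !mulr_ge0.
have d0 : 0 < 2 * (2 + n.+1%:R * (3 * N%:R)) :> R by lra.
rewrite !lt_min (divr_gt0 (gap_gt0 n) d0) invr_gt0 exprn_gt0//=.
by rewrite divr_gt0// energy_cst_gt0.
Qed.

Lemma width_gap n : width n * (2 * (2 + n.+1%:R * (3 * N%:R))) <= gap n.
Proof.
have N3 : 0 <= n.+1%:R * (3 * N%:R) :> R by rewrite !mulr_ge0.
by rewrite -ler_pdivlMr; [rewrite /width !ge_min lexx | lra].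
Qed.

Lemma width_pow n : width n <= 2 ^- n.
Proof. by rewrite /width !ge_min lexx orbT. Qed.

Lemma width_energy n : B n <= energy_cst n / width n.
Proof.
rewrite ler_pdivlMr ?width_gt0// mulrC -ler_pdivlMr//.
by rewrite /width ge_min lexx orbT.
Qed.

Lemma width4_le_gap n : 4 * width n <= gap n.
Proof.
apply: le_trans (width_gap n); have := width_gt0 n.
have : 0 <= n.+1%:R * (3 * N%:R) :> R by rewrite !mulr_ge0.
nra.
Qed.

Lemma gap_le_loc n : gap n <= loc n.
Proof. by rewrite loc_gap lerDr ltW// loc_gt0. Qed.

Lemma width_le_loc n : width n <= loc n.
Proof. have := width4_le_gap n; have := gap_le_loc n; have := width_gt0 n; lra. Qed.

Lemma loc_le_inv n : 4 * loc n <= n.+1%:R^-1.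
Proof.
by rewrite /loc mulrA ler_piMl//; have := c_le; lra.
Qed.

Lemma loc_width_le n : loc n + width n <= n.+1%:R^-1.
Proof.
have := loc_le_inv n; have := width_le_loc n; have := loc_gt0 n.
move: (loc n) (width n) (_^-1) => l w i; lra.
Qed.

Lemma loc_width_le_half n : loc n + width n <= (2 * N%:R)^-1.
Proof.
have := width_le_loc n; have := loc_dec _ _ (leq0n n).
have -> : loc 0 = (2 * N%:R)^-1 / 2.
  by rewrite /loc divr1 -invfM; congr (_^-1); ring.
move: (loc n) (width n) (_^-1) => l w i; lra.
Qed.

Lemma width_le1 n : width n <= 1.
Proof.
have := loc_width_le n; have := loc_gt0 n.
have : n.+1%:R^-1 <= 1 :> R by rewrite invf_le1// ler1n.
move: (loc n) (width n) (_^-1) => l w i; lra.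
Qed.

(** On the support [t >= loc n >= width n], and the [k]-th derivative is at most
    [width^(order - k) C <= width^4 C]. This splits into [width C], [width] and [width^2], at most
    1, [2^-n] and [t^2] respectively. *)
Lemma sbump_small (k : nat) : exists n0, forall n, (n0 <= n)%N ->
  forall t, `|sbump loc width height n k t| <= 2 ^- n * t ^+ 2.
Proof.
have [C C0 hC] := @derive1n_bump_bounded R k.
(* The first bound gives [order n >= k + 4]; the second gives [C <= n + 1], hence
   [width n * C <= 1]. *)
exists (maxn ((k + 4) * (2 * N)) (Num.truncn C)) => n; rewrite geq_max => /andP[nk nC] t.
have N20 : (0 < 2 * N)%N by lia.
have qk : (k + 4 <= order n)%N by rewrite /order leq_divRL.
have w0 := width_gt0 n; have w1 := width_le1 n.
have [tl|tl] := ltP t (loc n).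
  rewrite sbump_out ?normr0; [|exact: width_gt0|by left].
  by rewrite mulr_ge0 ?sqr_ge0// invr_ge0 exprn_ge0.
rewrite /sbump normrM ger0_norm; last first.
  by rewrite mulr_ge0// ?invr_ge0 exprn_ge0// ltW.
have wC : width n * C <= 1.
  have := loc_width_le n; have := loc_gt0 n.
  have Cn : C <= n.+1%:R.
    by apply: le_trans (ltW (truncnS_gt _)) _; rewrite ler_nat ltnS.
  move=> l0 lw; apply: (@le_trans _ _ (n.+1%:R^-1 * n.+1%:R)).
    apply: ler_pM => //; [exact: ltW|exact: ltW|].
    by apply: le_trans lw; rewrite lerDr ltW.
  by rewrite mulVf// pnatr_eq0.
have hk : height n * width n ^- k <= width n ^+ 4.
  rewrite /height ler_pdivrMr ?exprn_gt0// -exprD.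
  by apply: ler_wiXn2l => //; [exact: ltW|rewrite addnC].
apply: (@le_trans _ _ (width n ^+ 4 * C)).
  apply: ler_pM => //.
  by rewrite mulr_ge0// ?invr_ge0 exprn_ge0// ltW.
have -> : width n ^+ 4 * C = (width n * C * width n) * width n ^+ 2 by ring.
apply: ler_pM; [by rewrite !mulr_ge0// ltW|exact: sqr_ge0| |].
  apply: le_trans (width_pow n); rewrite ler_piMl// ltW//.
apply: lerXn2r; rewrite ?nnegrE; [exact: ltW| |].
- by have := loc_gt0 n; lra.
- by apply: le_trans tl; exact: width_le_loc.
Qed.

Definition profile : nat -> R -> R := bumps loc width height.

Lemma is_derive_profile k (x : R) : is_derive x 1 (profile k) (profile k.+1 x).
Proof.
apply: is_derive_bumps; [exact: width_gt0|exact: loc_gt0|exact: loc_dec|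
  exact: loc_width_le|exact: sbump_small].
Qed.

Lemma profile_out t : t < 0 \/ (2 * N%:R)^-1 < t -> profile 0 t = 0.
Proof.
move=> h; apply: bumps_out; [exact: width_gt0|exact: loc_gt0|].
by case: h => h; [left|right => n; exact: le_lt_trans (loc_width_le_half n) h].
Qed.

(** The radius stays below [gap n / 2], while the bumps to the left end at least [3/4] of [gap n]
    below [loc n] and those to the right begin at least [gap n] above it. *)
Lemma profile_isolated n t :
  `|t - loc n| <= (1 + n.+1%:R * (3 * N%:R)) * width n ->
  profile 0 t = sbump loc width height n 0 t.
Proof.
move=> ht; have w0 := width_gt0 n; have wg := width_gap n.
have {}ht : `|t - loc n| < gap n / 2 by apply: le_lt_trans ht _; lra.
move: ht; rewrite ltr_norml => /andP[t1 t2].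
apply: bumps_single; [exact: width_gt0|exact: loc_gt0|exact: loc_width_le|].
move=> m mn; have := gap_gt0 n => g0.
have [mn'|mn'|/eqP] := ltngtP m n; last by rewrite (negbTE mn).
- left; case: n mn mn' t1 t2 w0 wg g0 => // n mn mn' t1 t2 w0 wg g0.
  apply: lt_le_trans (loc_dec m n mn').
  by have := loc_gap n; have := gap_dec _ _ (leqnSn n); lra.
- right; have := loc_dec _ _ mn'; have := loc_gap n.
  have := gap_dec _ _ (ltnW mn'); have := width4_le_gap m; lra.
Qed.

Lemma profile_ge n t : loc n + width n / 4 <= t <= loc n + 3 * width n / 4 ->
  height n * expR (- 8) <= profile 0 t.
Proof.
move=> /andP[t1 t2]; have w0 := width_gt0 n.
rewrite (profile_isolated n); last first.
  rewrite ler_norml; have : 0 <= n.+1%:R * (3 * N%:R) * width n.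
    by rewrite !mulr_ge0// ltW.
  by move=> h; apply/andP; split; lra.
rewrite /sbump expr0 invr1 mulr1 derive1n0 ler_wpM2l ?exprn_ge0 ?(ltW w0)//.
by apply: bump_ge; rewrite ler_pdivlMr// ler_pdivrMr//; apply/andP; split; lra.
Qed.

(** A displacement of at least twice the width leaves the [n]-th bump, and its upper bound keeps [t]
    away from all the others. *)
Lemma profile_eq0 n x t : loc n + width n / 4 <= x <= loc n + 3 * width n / 4 ->
  2 * width n <= `|t - x| -> `|t - x| <= n.+1%:R * (3 * N%:R * width n) ->
  profile 0 t = 0.
Proof.
move=> /andP[x1 x2] h1 h2; have w0 := width_gt0 n.
rewrite (profile_isolated n); last first.
  have -> : t - loc n = (t - x) + (x - loc n) by ring.
  apply: le_trans (ler_normD _ _) _; rewrite mulrDl addrC lerD//.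
    by rewrite ler_norml; lra.
  by rewrite -mulrA.
apply: sbump_out; first exact: width_gt0.
have [tx|tx] := leP 0 (t - x).
  by rewrite ger0_norm// in h1; right; lra.
by rewrite ltr0_norm// in h1; left; lra.
Qed.

(** Count powers of the width, which is at most 1: the exponent [2N order + N + 1 - (2n+1)] is at
    most [N - n <= -1], by [2N order <= n] and [N < n]. *)
Lemma energy_scaling n : (N < n)%N ->
  energy_cst n / width n <=
  (1 / (2 ^+ (2 * n.+1) * (2 ^+ (2 * n.+1).+1 * (pi / 2)))) *
    (((height n * expR (- 8)) ^+ N) ^+ 2 * (width n / 2) ^+ N *
     (3 * N%:R * width n) ^- (2 * n).+1 * (N%:R * width n)).
Proof.
move=> Nn; have w0 := width_gt0 n; have w1 := width_le1 n.
set K1 := 1 / _.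
have -> : K1 * (((height n * expR (- 8)) ^+ N) ^+ 2 * (width n / 2) ^+ N *
     (3 * N%:R * width n) ^- (2 * n).+1 * (N%:R * width n)) =
   energy_cst n * (width n ^+ (order n * (2 * N) + N + 1) * width n ^- (2 * n).+1).
  rewrite /energy_cst -/K1 /height.
  have -> : ((width n ^+ order n * expR (- 8)) ^+ N) ^+ 2 =
      width n ^+ (order n * (2 * N)) * expR (- 8) ^+ (2 * N).
    by rewrite -exprM exprMn -exprM (mulnC N 2).
  have -> : (width n / 2) ^+ N = width n ^+ N * 2 ^- N by rewrite exprMn exprVn.
  rewrite exprMn invfM !exprD expr1.
  move: (width n ^+ (order n * (2 * N))) (width n ^- _) ((3 * N%:R) ^- _) => p1 p2 p3.
  ring.
rewrite ler_pM2l ?energy_cst_gt0// ler_pdivlMr ?exprn_gt0// exprS mulrA mulVf ?gt_eqF// mul1r.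
apply: ler_wiXn2l => //; first exact: ltW.
have := leq_divM n (2 * N); rewrite -/(order n); lia.
Qed.

End BumpParameters.

(** * The test function and divergence of the energy integral *)

Lemma exists_large_energy {R : realType} (N : nat) (B : nat -> R) :
  (0 < N)%N -> (forall n, 0 < B n) ->
  exists u : 'rV[R]_N -> R, Cc_infty_B1 u /\
    forall (sigma : R -> {measure set (@RN R N) -> \bar R}) (e : R -> 'rV[R]_N) n s,
      sigma s setT = 1%E -> sigma s (~` @sphere R N) = 0%E ->
      (N < n)%N -> n%:R <= s < n.+1%:R -> @sphere R N (e s) ->
      (0 < Mfun s (sigma s) (e s))%E -> ((B n)%:E <= Eform sigma e s u)%E.
Proof.
move=> N0 B0; exists (fun x => \prod_(i < N) profile N B 0 (x 0 i)); split.
  apply: (@Cc_infty_B1_prod _ _ _ _ (2 * N%:R)^-1) => //.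
  - by move=> k x; exact: is_derive_profile.
  - by rewrite mulVf// mulf_neq0// pnatr_eq0 -lt0n.
  - by move=> t; exact: profile_out.
move=> sigma e n s sT sC Nn ns eS M0.
have N1 : 1 <= N%:R :> R by rewrite ler1n.
have w0 := width_gt0 N B N0 B0 n.
have h0 : 0 <= height N B n * expR (- 8).
  by rewrite mulr_ge0 ?expR_ge0// exprn_ge0// ltW.
(* Each of the [N] factors is at least [height * exp(-8)] on the middle half of the bump, whence the
   [N]-th power as the value [v]. *)
apply: le_trans (Eform_bump_ge _ _ n _ _ (loc N n) (width N B n)
  ((height N B n * expR (- 8)) ^+ N) N0 sT sC _ ns eS M0 w0 _ _ _ _).
- rewrite lee_fin; apply: le_trans (width_energy N B N0 B0 n) _.
  exact: energy_scaling.
- by apply: leq_ltn_trans Nn.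
- have i1 : n.+1%:R^-1 <= 1 :> R by rewrite invf_le1// ler1n.
  have l1 := le_trans (loc_le_inv N N0 n) i1.
  have l0 := loc_gt0 N N0 n.
  have wg := le_trans (width_gap N B n) (gap_le_loc N N0 n).
  have Nw : 0 <= 3 * N%:R * width N B n by rewrite !mulr_ge0// ltW.
  have : 3 * N%:R * width N B n <= n.+1%:R * (3 * N%:R * width N B n).
    by rewrite ler_peMl// ler1n.
  lra.
- exact: exprn_ge0.
- move=> x xb; rewrite -[X in _ ^+ X]card_ord -prodr_const.
  by apply: ler_prod => i _; rewrite h0 profile_ge.
(* A single coordinate moved off its bump kills the whole product. *)
- move=> x z xb [i zi] zb; rewrite (bigD1 i)//= (profile_eq0 N B N0 B0 n (x 0 i)) ?mul0r//.
Qed.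

(** If all the intervals from [k] on were null, a unit ball centred at distance more than [k + 1]
    from 0 would lie in their union or in the null negative axis, so the support would be
    bounded. *)
Lemma msupp_unbounded_charge {R : realType} (mu : {measure set R -> \bar R}) (k : nat) :
  mu `]-oo, 0%R[%classic = 0%E ->
  (~ exists M : R, forall x, msupp mu x -> `|x| <= M) ->
  exists2 n, (k <= n)%N & (0 < mu `[n%:R, n.+1%:R[%classic)%E.
Proof.
move=> mu_neg mu_supp; apply: contrapT => H.
have I0 n : (k <= n)%N -> mu `[n%:R, n.+1%:R[%classic = 0%E.
  move=> kn; apply/eqP; rewrite eq_le measure_ge0 andbT leNgt; apply/negP => h.
  by apply: H; exists n.
have ball_itv (x : R) : ball x 1 = `]x - 1, x + 1[%classic by exact: ball_itv.
apply: mu_supp; exists k.+1%:R => x /(_ 1 ltr01); rewrite ball_itv => px.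
rewrite leNgt; apply/negP => kx.
have k0 : 0 <= k%:R :> R by [].
have k1 : k.+1%:R = k%:R + 1 :> R by rewrite -natr1.
suff : mu.-negligible `]x - 1, x + 1[%classic.
  by move/measure_negligible => /(_ (measurable_itv _)) h; rewrite h ltxx in px.
have [x0|x0] := ltP x 0.
  apply: (@negligibleS _ _ _ mu `]-oo, 0[%classic).
    move=> y /=; rewrite !in_itv/= => /andP[_ y1].
    by rewrite ltr0_norm// in kx; lra.
  by apply/negligibleP.
rewrite ger0_norm// in kx.
apply: (@negligibleS _ _ _ mu (\bigcup_n `[(k + n)%N%:R, (k + n).+1%:R[%classic)).
  move=> y /=; rewrite !in_itv/= => /andP[y1 _].
  have y0 : k%:R <= y by lra.
  have yk : (k <= Num.truncn y)%N by rewrite truncn_ge_nat// (le_trans k0 y0).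
  exists (Num.truncn y - k)%N => //=; rewrite in_itv/= subnKC//.
  by apply/truncn_itv; lra.
apply: negligible_bigcup => n; apply/negligibleP => //.
by apply: I0; exact: leq_addr.
Qed.

Theorem theorem5p4 (R : realType) (N : nat) (N_gt0 : (0 < N)%N)
  (sigma : R -> {measure set (@RN R N) -> \bar R})
  (e : R -> 'rV[R]_N)
  (mu : {measure set R -> \bar R})
  (sigma_prob : forall s : R, 0 < s ->
     sigma s setT = 1%E /\ sigma s (~` @sphere R N) = 0%E)
  (e_max : forall s : R, 0 < s ->
     @sphere R N (e s) /\
     forall e' : 'rV[R]_N, @sphere R N e' -> (Mfun s (sigma s) e' <= Mfun s (sigma s) (e s))%E)
  (mu_fin : (mu setT < +oo)%E)
  (mu_pos : mu `]-oo, 0%R[%classic = 0%E)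
  (mu_supp : ~ exists M : R, forall x, msupp mu x -> `|x| <= M)
  (M_inf : (0 < ereal_inf [set Mfun s (sigma s) (e s) | s in `]0%R, +oo[%classic])%E)
  (nu_meas : forall A : set 'rV[R]_N, (@open 'rV[R]_N).-sigma.-measurable A ->
     mu_measurable mu `]0, +oo[%classic (fun s => nu (sigma s) s A)) :
  exists u : 'rV[R]_N -> R, Cc_infty_B1 u /\
    (\int[mu]_(s in `[0%R, +oo[%classic) Eform sigma e s u = +oo)%E.
Proof.
pose p n := mu `[n%:R, n.+1%:R[%classic.
(* The default 1 on null intervals keeps the prescribed energy levels positive. *)
pose q n : R := if (0 < p n)%E then fine (p n) else 1.
have p_fin n : p n \is a fin_num.
  rewrite ge0_fin_numE//; apply: le_lt_trans mu_fin.
  by apply: le_measure; rewrite ?inE.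
have q0 n : 0 < q n.
  rewrite /q; case: ifPn => // pn; rewrite fine_gt0// pn/=.
  by rewrite -ge0_fin_numE// ltW.
have B0 n : 0 < n.+1%:R / q n by rewrite divr_gt0.
have [u [u_smooth u_energy]] := exists_large_energy N _ N_gt0 B0.
(* For each [A] one charged interval suffices: energy at least [(n+1) / q n] on a set of mass [q n]
   contributes [n + 1], which exceeds [A] once [n >= truncn A]. *)
exists u; split => //; apply/eqyP => A A0.
have [n] := msupp_unbounded_charge mu (maxn N.+1 (Num.truncn A)) mu_pos mu_supp.
rewrite geq_max => /andP[Nn An]; rewrite -/(p n) => pn.
apply: (@le_trans _ _ ((n.+1%:R / q n)%:E * p n)%E).
  rewrite /q pn -{2}(fineK (p_fin n)) -EFinM divfK ?gt_eqF ?fine_gt0//; last first.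
    by rewrite pn/= -ge0_fin_numE// ltW.
  by rewrite lee_fin (le_trans (ltW (truncnS_gt _)))// ler_nat ltnS.
apply: integral_ge_cst.
- exact: measurable_itv.
- by move=> s /=; rewrite !in_itv/= andbT => /andP[sn _]; exact: le_trans sn.
- exact: ltW.
- by move=> s _; exact: Eform_ge0.
move=> s /=; rewrite in_itv/= => sn.
have s0 : 0 < s.
  have /andP[h _] := sn; apply: lt_le_trans h; rewrite ltr0n.
  exact: leq_ltn_trans Nn.
have [sT sC] := sigma_prob s s0; have [eS _] := e_max s s0.
apply: u_energy => //; apply: lt_le_trans M_inf _; apply: ereal_inf_lbound.
by exists s => //=; rewrite in_itv/= s0.
Qed.
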